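(* Let $\mathcal{P}$ be a partition of $\mathcal{S}$ and let $x^*$ be (the $x$-part of) an optimal solution of the problem $$\min_{x\in\mathcal{X},\,\theta\in\mathbb{R}^{|\mathcal{S}|}}\ c^\intercal x+\sum_{s\in\mathcal{S}}p^s\theta^s$$ subject to $$p^P(h^P-T^Px)^\intercal\hat\lambda\le\sum_{s\in P}p^s\theta^s\quad\text{for all }\hat\lambda\in\mathrm{XP}(\Lambda),\ P\in\mathcal{P},$$ $$(h^s-T^sx)^\intercal\tilde\lambda\le 0\quad\text{for all }\tilde\lambda\in\mathrm{XR}(\Lambda),\ s\in\mathcal{S}.$$ Suppose that there exist optimal dual solutions $\hat\lambda^s$ of the subproblems $Q(x^*,\xi^s)$, $s\in\mathcal{S}$, that satisfy, for all $P\in\mathcal{P}$, $$\Big(\sum_{s\in P}p^s\Big)\cdot\sum_{s\in P}p^s\big((h^s)^\intercal\hat\lambda^s\big)=\Big(\sum_{s\in P}p^sh^s\Big)^\intercal\Big(\sum_{s\in P}p^s\hat\lambda^s\Big),$$ $$\Big(\sum_{s\in P}p^s\Big)\cdot\sum_{s\in P}p^s\big((T^sx^* )^\intercal\hat\lambda^s\big)=\Big(\sum_{s\in P}p^sT^sx^*\Big)^\intercal\Big(\sum_{s\in P}p^s\hat\lambda^s\Big).$$ Then $x^*$ is also an optimal solution of $\min_{x\in\mathcal{X}}c^\intercal x+\sum_{s\in\mathcal{S}}p^sQ(x,\xi^s)$.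
   Context: Setting: a two-stage linear stochastic program with fixed recourse, $\min_{x\in\mathcal{X}}c^\intercal x+\sum_{s\in\mathcal{S}}p^sQ(x,\xi^s)$, where $c\in\mathbb{R}^n$, $\mathcal{X}\subseteq\mathbb{R}^n$ is a nonempty closed (polyhedral, possibly with integrality restrictions on some variables) set, $\mathcal{S}$ is a finite set of scenarios with probabilities $p^s>0$ (summing to 1), $\xi^s=(T^s,h^s)$ with $T^s\in\mathbb{R}^{p\times n}$, $h^s\in\mathbb{R}^p$, and $Q(x,\xi^s)=\min\{q^\intercal y: Wy=h^s-T^sx,\ y\ge 0\}$ with fixed $W\in\mathbb{R}^{p\times m}$ and $q\in\mathbb{R}^m$ (with value $+\infty$ if infeasible). It is assumed that there is some $\bar x$ such that $Q(\bar x,\xi^s)$ is feasible and bounded for all $s\in\mathcal{S}$. The LP dual of the subproblem $Q(x,\xi^s)$ is $\max\{(h^s-T^sx)^\intercal\lambda:\lambda\in\Lambda\}$ with $\Lambda=\{\lambda\in\mathbb{R}^p: W^\intercal\lambda\le q\}$; an optimal dual solution is an optimal solution of this LP. $\mathrm{XP}(\Lambda)$ and $\mathrm{XR}(\Lambda)$ denote the sets of extreme points and extreme rays of $\Lambda$. For nonempty $P\subseteq\mathcal{S}$: $p^P=\sum_{s\in P}p^s$, $h^P=\frac{1}{p^P}\sum_{s\in P}p^sh^s$, $T^P=\frac{1}{p^P}\sum_{s\in P}p^sT^s$. *)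

(* Defs.v *)
From HB Require Import structures.
From mathcomp Require Export all_boot all_order all_algebra.
From mathcomp Require Export all_classical all_reals all_analysis.
Export Order.TTheory GRing.Theory Num.Theory.
Export numFieldNormedType.Exports.

Set Implicit Arguments.
Unset Strict Implicit.
Unset Printing Implicit Defensive.

Local Open Scope classical_set_scope.
Local Open Scope ring_scope.

Definition dot (R : realType) (n : nat) (u v : 'cV[R]_n) : R := (u^T *m v) 0 0.

(* An optimal solution must be feasible, so the optimal value has to be finite:
   a point of [D] where [f] is [+oo] is an infeasible point of the program. *)
Definition is_minimizer (R : realType) (T : Type)
    (D : set T) (f : T -> \bar R) (x : T) : Prop :=
  [/\ D x, f x \is a fin_num & forall y, D y -> (f x <= f y)%E].

Definition is_maximizer (R : realType) (T : Type)
    (D : set T) (f : T -> R) (x : T) : Prop :=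
  D x /\ forall y, D y -> f y <= f x.

Definition extreme_points (R : realType) (k : nat) (A : set 'cV[R]_k) :
    set 'cV[R]_k :=
  [set l | A l /\ forall (a b : 'cV[R]_k) (t : R), A a -> A b -> 0 < t < 1 ->
     l = t *: a + (1 - t) *: b -> a = l /\ b = l].

Definition recession_cone (R : realType) (k : nat) (A : set 'cV[R]_k) :
    set 'cV[R]_k :=
  [set r | forall (l : 'cV[R]_k) (t : R), A l -> 0 <= t -> A (l + t *: r)].

(* All nonzero generators of the extreme rays of the recession cone, not one
   representative per ray. *)
Definition extreme_rays (R : realType) (k : nat) (A : set 'cV[R]_k) :
    set 'cV[R]_k :=
  [set r | [/\ recession_cone A r, r != 0 &
     forall u v : 'cV[R]_k, recession_cone A u -> recession_cone A v ->
       r = u + v ->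
       exists a b : R, [/\ 0 <= a, 0 <= b, u = a *: r & v = b *: r]]].

Definition dual_polyhedron (R : realType) (k m : nat)
    (W : 'M[R]_(k, m)) (q : 'cV[R]_m) : set 'cV[R]_k :=
  [set l | forall j, (W^T *m l) j 0 <= q j 0].

Definition recourse_set (R : realType) (k m n : nat) (W : 'M[R]_(k, m))
    (T : 'M[R]_(k, n)) (h : 'cV[R]_k) (x : 'cV[R]_n) : set 'cV[R]_m :=
  [set y | W *m y = h - T *m x /\ forall j, 0 <= y j 0].

(* Optimal value of the second-stage program; [+oo] if it is infeasible and
   [-oo] if it is unbounded. *)
Definition recourse (R : realType) (k m n : nat) (W : 'M[R]_(k, m))
    (q : 'cV[R]_m) (T : 'M[R]_(k, n)) (h : 'cV[R]_k) (x : 'cV[R]_n) : \bar R :=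
  ereal_inf [set (dot q y)%:E | y in recourse_set W T h x].

Definition recourse_feasible_bounded (R : realType) (k m n : nat)
    (W : 'M[R]_(k, m)) (q : 'cV[R]_m)
    (T : 'M[R]_(k, n)) (h : 'cV[R]_k) (x : 'cV[R]_n) : Prop :=
  has_inf [set dot q y | y in recourse_set W T h x].

Definition is_optimal_dual (R : realType) (k m n : nat) (W : 'M[R]_(k, m))
    (q : 'cV[R]_m) (T : 'M[R]_(k, n)) (h : 'cV[R]_k) (x : 'cV[R]_n)
    (l : 'cV[R]_k) : Prop :=
  is_maximizer (dual_polyhedron W q) (dot (h - T *m x)) l.

Definition two_stage_cost (R : realType) (S : finType) (k m n : nat)
    (W : 'M[R]_(k, m)) (q : 'cV[R]_m) (c : 'cV[R]_n) (p : S -> R)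
    (T : S -> 'M[R]_(k, n)) (h : S -> 'cV[R]_k) (x : 'cV[R]_n) : \bar R :=
  ((dot c x)%:E + \sum_(s : S) (p s)%:E * recourse W q (T s) (h s) x)%E.

Definition agg_prob (R : realType) (S : finType) (p : S -> R) (P : {set S}) : R :=
  \sum_(s in P) p s.

Definition agg (R : realType) (S : finType) (V : lmodType R) (p : S -> R)
    (v : S -> V) (P : {set S}) : V :=
  (agg_prob p P)^-1 *: \sum_(s in P) p s *: v s.

Definition master_set (R : realType) (S : finType) (k m n : nat)
    (X : set 'cV[R]_n) (W : 'M[R]_(k, m)) (q : 'cV[R]_m) (p : S -> R)
    (T : S -> 'M[R]_(k, n)) (h : S -> 'cV[R]_k) (Part : {set {set S}}) :
    set ('cV[R]_n * (S -> R)) :=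
  [set z | [/\ X z.1,
     forall (l : 'cV[R]_k) (P : {set S}),
       extreme_points (dual_polyhedron W q) l -> P \in Part ->
       agg_prob p P * dot (agg p h P - agg p T P *m z.1) l
         <= \sum_(s in P) p s * z.2 s
   & forall (r : 'cV[R]_k) (s : S),
       extreme_rays (dual_polyhedron W q) r ->
       dot (h s - T s *m z.1) r <= 0]].

Definition master_cost (R : realType) (S : finType) (n : nat) (c : 'cV[R]_n)
    (p : S -> R) (z : 'cV[R]_n * (S -> R)) : \bar R :=
  (dot c z.1 + \sum_(s : S) p s * z.2 s)%:E.

(* Main.v *)
Require Import Defs.
From mathcomp Require Import zify ring lra.

(* The values [Q(y, xi^s)] of any [y] with finite cost extend [y] to a feasible
   point of the master problem, by weak duality, so the master optimum is a lower
   bound for the two-stage problem. Conversely, strong duality turns the cost of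
   [x*] into a sum of [p^s (h^s - T^s x* )^T lam^s]; the hypothesis on the duals says
   that on each block this sum is the aggregated functional at the averaged dual
   solution, which lies in [Lambda]. This functional is bounded on [Lambda], so
   some extreme point does at least as well, and the corresponding cut of the
   master problem bounds the block by [sum p^s theta^s]. *)

Set Implicit Arguments.
Unset Strict Implicit.

Local Open Scope classical_set_scope.
Local Open Scope ring_scope.

(** * Bilinearity and positivity of the dot product *)

Section Dot.
Context {R : realType} {n : nat}.
Implicit Types u v w : 'cV[R]_n.

Lemma dotC u v : dot u v = dot v u.
Proof. by rewrite /dot -[u^T *m v]trmxK trmx_mul trmxK mxE. Qed.

Lemma dotDr u v w : dot u (v + w) = dot u v + dot u w.
Proof. by rewrite /dot mulmxDr mxE. Qed.

Lemma dotZr a u v : dot u (a *: v) = a * dot u v.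
Proof. by rewrite /dot -scalemxAr mxE. Qed.

Lemma dot0r u : dot u 0 = 0.
Proof. by rewrite /dot mulmx0 mxE. Qed.

Lemma dotDl u v w : dot (u + v) w = dot u w + dot v w.
Proof. by rewrite dotC dotDr !(dotC w). Qed.

Lemma dotZl a u v : dot (a *: u) v = a * dot u v.
Proof. by rewrite dotC dotZr dotC. Qed.

Lemma dotBl u v w : dot (u - v) w = dot u w - dot v w.
Proof. by rewrite dotDl -scaleN1r dotZl mulN1r. Qed.

Lemma dotBr u v w : dot u (v - w) = dot u v - dot u w.
Proof. by rewrite dotC dotBl !(dotC u). Qed.

Lemma dot_suml (I : finType) (A : pred I) (F : I -> 'cV[R]_n) v :
  dot (\sum_(i | A i) F i) v = \sum_(i | A i) dot (F i) v.
Proof.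
apply: (big_morph (fun u => dot u v)) => [u w|]; first exact: dotDl.
by rewrite dotC dot0r.
Qed.

Lemma dotE u v : dot u v = \sum_i u i 0 * v i 0.
Proof. by rewrite /dot mxE; apply: eq_bigr => i _; rewrite mxE. Qed.

Lemma dot_self_gt0 u : u != 0 -> 0 < dot u u.
Proof.
move=> u0; rewrite lt_def dotE sumr_ge0 ?andbT; last first.
  by move=> i _; exact: sqr_ge0.
apply: contra u0; rewrite psumr_eq0 => [/allP u0|i _]; last exact: sqr_ge0.
apply/eqP/colP => i; rewrite mxE; apply/eqP.
by rewrite -sqrf_eq0 expr2 (eqP (u0 i (mem_index_enum i))).
Qed.

End Dot.

(** * Transposition and Farkas' lemma *)

Lemma dot_mulmx (R : realType) (k m : nat) (W : 'M[R]_(k, m)) y l :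
  dot (W *m y) l = dot y (W^T *m l).
Proof. by rewrite /dot trmx_mul mulmxA. Qed.

Lemma mulmx_tr_dot (R : realType) (k m : nat) (W : 'M[R]_(k, m)) l j :
  (W^T *m l) j 0 = dot (col j W) l.
Proof. by rewrite mxE dotE; apply: eq_bigr => i _; rewrite !mxE. Qed.

(* Induction on the number of generators: if the functional [l] separating [b]
   from the other generators is positive on the new generator [a0], project
   everything onto the kernel of [l] along [a0]. *)
Lemma farkas (R : realType) (k m : nat) (a : 'I_m -> 'cV[R]_k) (b : 'cV[R]_k) :
  (exists2 y : 'I_m -> R, forall i, 0 <= y i & b = \sum_i y i *: a i) \/
  (exists2 l, forall i, dot (a i) l <= 0 & 0 < dot b l).
Proof.
elim: m a b => [|m IH] a b.
  have [->|b0] := eqVneq b 0.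
    by left; exists (fun=> 0) => //; rewrite big_ord0.
  by right; exists b; [case|exact: dot_self_gt0].
case: (IH (a \o lift ord0) b) => [[y y0 bE]|[l al bl]].
  left; exists (fun i => if unlift ord0 i is Some j then y j else 0).
    by move=> i; case: unliftP.
  rewrite big_ord_recl unlift_none scale0r add0r bE.
  by apply: eq_bigr => i _; rewrite liftK.
set a0 := a ord0.
have [a0l|a0l] := leP (dot a0 l) 0.
  right; exists l => // i; case: (unliftP ord0 i) => [j|] -> //; exact: al.
have a0n : dot a0 l != 0 by rewrite gt_eqF.
pose pr v := v - (dot v l / dot a0 l) *: a0.
case: (IH (pr \o a \o lift ord0) (pr b)) => [[y y0 bE]|[mu amu bmu]].
  (* Undoing the projections collects this coefficient on [a0]. It is nonnegative because [l] is
     positive at [b] and [a0] and nonpositive at the other generators. *)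
  pose y00 := dot b l / dot a0 l
    - \sum_i y i * (dot (a (lift ord0 i)) l / dot a0 l).
  left; exists (fun i => if unlift ord0 i is Some j then y j else y00).
    move=> i; case: unliftP => // _; rewrite /y00 subr_ge0.
    apply: (@le_trans _ _ 0); last by rewrite divr_ge0 // ltW.
    apply: sumr_le0 => j _; rewrite mulr_ge0_le0 //.
    by rewrite pmulr_lle0 ?invr_gt0 //; exact: al.
  rewrite big_ord_recl unlift_none -/a0.
  under eq_bigr do rewrite liftK.
  rewrite /y00 scalerBl scaler_suml.
  move/eqP: bE; rewrite /pr subr_eq /= => /eqP {1}->.
  rewrite addrC -addrA; congr (_ + _).
  rewrite addrC -sumrB; apply: eq_bigr => i _.
  by rewrite scalerBr scalerA.
(* The correction makes the functional vanish on [a0], so its value at any [v] is that of [mu] at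
   [pr v]. *)
right; exists (mu - (dot a0 mu / dot a0 l) *: l).
  move=> i; rewrite dotBr dotZr.
  case: (unliftP ord0 i) => [j|] ->; last by rewrite -/a0 divfK ?subrr.
  by move: (amu j); rewrite /= /pr dotBl dotZl; congr (_ <= _); field.
move: bmu; rewrite /pr dotBl dotZl dotBr dotZr.
by congr (_ < _); field.
Qed.

(** * Extreme points of the dual polyhedron and LP duality *)

Section Duality.
Context {R : realType} {k m : nat}.
Variables (W : 'M[R]_(k, m)) (q : 'cV[R]_m).
Local Notation Lambda := (dual_polyhedron W q).

Lemma dual_recession_le0 l r :
  Lambda l -> recession_cone Lambda r -> forall j, (W^T *m r) j 0 <= 0.
Proof.
move=> Ll Lr j; rewrite leNgt; apply/negP => rj.
have lj := Ll j.
(* With this step length, constraint [j] would be exceeded by exactly 1. *)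
pose t := (q j 0 - (W^T *m l) j 0 + 1) / (W^T *m r) j 0.
have t0 : 0 <= t by rewrite divr_ge0 ?(ltW rj) //; lra.
have := Lr l t Ll t0 j.
rewrite mulmxDr -scalemxAr mxE [X in _ + X]mxE /t divfK ?gt_eqF //; lra.
Qed.

(** Ratio test: the step is the least quotient of slack by growth rate over the constraints that
    grow along [d]. It is positive because tight constraints do not grow. *)
Lemma move_to_boundary l d j : Lambda l ->
  (forall i, (W^T *m l) i 0 = q i 0 -> (W^T *m d) i 0 <= 0) ->
  0 < (W^T *m d) j 0 ->
  exists t i, [/\ 0 < t, Lambda (l + t *: d), (W^T *m l) i 0 != q i 0
    & (W^T *m (l + t *: d)) i 0 = q i 0].
Proof.
move=> Ll tight dj.
pose ratio i := (q i 0 - (W^T *m l) i 0) / (W^T *m d) i 0.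
have E t i : (W^T *m (l + t *: d)) i 0 = (W^T *m l) i 0 + t * (W^T *m d) i 0.
  by rewrite mulmxDr -scalemxAr mxE [X in _ + X]mxE.
case: (Order.TotalTheory.arg_minP (P := fun i => 0 < (W^T *m d) i 0) ratio dj)
  => i0 di0 imin.
have li0 : (W^T *m l) i0 0 != q i0 0.
  by apply/eqP => /tight; rewrite leNgt di0.
have t0 : 0 < ratio i0.
  by rewrite divr_gt0 // subr_gt0 lt_neqAle li0; exact: Ll.
exists (ratio i0), i0; split=> // [i|].
  rewrite E; have [di|di] := leP ((W^T *m d) i 0) 0.
    by apply: le_trans (Ll i); rewrite gerDl mulr_ge0_le0 // ltW.
  by rewrite -lerBrDl -ler_pdivlMr //; exact: imin.
by rewrite E /ratio divfK ?gt_eqF // addrC subrK.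
Qed.

(** A point that is not extreme lies inside a segment of the polyhedron. Moving along its line
    without decreasing [b], until a new constraint becomes tight, lowers the number of slack
    constraints. The bound [M] rules out endless ascent, and the extreme point [l0] rules out
    lines. *)
Lemma extreme_point_dominates (b l0 l : 'cV[R]_k) (M : R) :
  extreme_points Lambda l0 -> (forall x, Lambda x -> dot b x <= M) ->
  Lambda l -> exists2 e, extreme_points Lambda e & dot b l <= dot b e.
Proof.
move=> [Ll0 ext0] bM.
have [N] := ubnP (m - #|[set i | (W^T *m l) i 0 == q i 0]%SET|).
elim: N l => // N IH l lN Ll.
have [le|/not_andP[//|]] := pselect (extreme_points Lambda l); first by exists l.
move=> /existsNP[a1] /existsNP[a2] /existsNP[t].
move=> /not_implyP[La1] /not_implyP[La2] /not_implyP[/andP[t0 t1]].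
move=> /not_implyP[lE nab].
pose d : 'cV[R]_k := a1 - a2.
have d0 : d != 0.
  rewrite subr_eq0; apply/eqP => a12; apply: nab; rewrite lE a12.
  by rewrite -scalerDl addrC subrK scale1r.
(* A constraint tight at [l] is tight at both endpoints, since [0 < t < 1]. *)
have tightd i : (W^T *m l) i 0 = q i 0 -> (W^T *m d) i 0 = 0.
  rewrite lE mulmxDr -!scalemxAr mulmxBr.
  move: (La1 i) (La2 i); rewrite !mxE; set x1 := \sum_j _; set x2 := \sum_j _.
  by move=> *; nra.
have step d' j : (d' = d \/ d' = - d) -> 0 <= dot b d' -> 0 < (W^T *m d') j 0 ->
    exists2 e, extreme_points Lambda e & dot b l <= dot b e.
  move=> dE bd dj.
  have tightd' i : (W^T *m l) i 0 = q i 0 -> (W^T *m d') i 0 = 0.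
    by move=> /tightd e; case: dE => ->; rewrite // mulmxN mxE e oppr0.
  have [s [i [s0 Ls li si]]] : exists s i, [/\ 0 < s, Lambda (l + s *: d'),
      (W^T *m l) i 0 != q i 0 & (W^T *m (l + s *: d')) i 0 = q i 0].
    by apply: move_to_boundary Ll _ dj => i /tightd' ->.
  (* Tight constraints are constant along [d'], so they stay tight, and [i] joins them. *)
  have pr : [set i | (W^T *m l) i 0 == q i 0]%SET
      \proper [set i | (W^T *m (l + s *: d')) i 0 == q i 0]%SET.
    apply/properP; split; last by exists i; rewrite inE ?si ?eqxx.
    apply/fintype.subsetP => i'; rewrite !inE => /eqP li'.
    by rewrite mulmxDr -scalemxAr mxE [X in _ + X]mxE tightd' // mulr0 addr0 li'.
  have [] := IH (l + s *: d') _ Ls.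
    move: (proper_card pr) lN; set A := #|_|; set B := #|_| => AB.
    have : (B <= m)%N by rewrite -[leqRHS]card_ord; exact: max_card.
    lia.
  move=> e ee le; exists e => //; apply: le_trans le.
  by rewrite dotDr dotZr lerDl mulr_ge0 // ltW.
have up d' : 0 < dot b d' -> exists j, 0 < (W^T *m d') j 0.
  move=> bd; apply: contrapT => /forallNP dle.
  (* At this step length the value of [b] would be [M + 1]. *)
  pose s := (M - dot b l + 1) / dot b d'.
  have s0 : 0 <= s by rewrite divr_ge0 ?(ltW bd)//; have := bM l Ll; lra.
  have /bM : Lambda (l + s *: d').
    move=> j; rewrite mulmxDr -scalemxAr mxE [X in _ + X]mxE.
    apply: le_trans (Ll j); rewrite gerDl mulr_ge0_le0 //.
    by rewrite leNgt; exact/negP/dle.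
  rewrite dotDr dotZr divfK ?gt_eqF //; lra.
have bN : dot b (- d) = - dot b d by rewrite -scaleN1r dotZr mulN1r.
have [bd|bd|bd] := ltgtP (dot b d) 0.
- have bd' : 0 < dot b (- d) by rewrite bN oppr_gt0.
  by have [j] := up _ bd'; apply: step (ltW bd'); right.
- by have [j] := up _ bd; apply: step (ltW bd); left.
(* Both directions now preserve the value of [b], so either one that meets a constraint will do. *)
have [[j dj]|/forallNP dle] := pselect (exists j, 0 < (W^T *m d) j 0).
  by apply: step dj; [left|rewrite bd].
have [[j dj]|/forallNP dge] := pselect (exists j, 0 < (W^T *m (- d)) j 0).
  by apply: step dj; [right|rewrite bN bd oppr0].
have Wd : W^T *m d = 0.
  apply/colP => j; apply/eqP; rewrite [eqbRHS]mxE eq_le !leNgt; apply/andP; split.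
    exact/negP/dle.
  by apply/negP => dj; apply: (dge j); rewrite mulmxN mxE oppr_gt0.
(* [l0] is the midpoint of a segment of the line [l0 + R d], which lies in the
   polyhedron. *)
have Lline s : Lambda (l0 + s *: d).
  by move=> j; rewrite mulmxDr -scalemxAr Wd scaler0 addr0; exact: Ll0.
have half : 0 < (2^-1 : R) < 1 by apply/andP; split; lra.
have [|e1 _] := ext0 _ _ _ (Lline 1) (Lline (-1)) half.
  by apply/colP => i; rewrite !mxE; field.
by move/eqP: e1; rewrite scale1r -subr_eq0 addrC addKr (negbTE d0).
Qed.

Context {n : nat}.
Variables (T : 'M[R]_(k, n)) (h : 'cV[R]_k) (x : 'cV[R]_n).

Lemma weak_duality y l :
  recourse_set W T h x y -> Lambda l -> dot (h - T *m x) l <= dot q y.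
Proof.
move=> [<- y0] Ll; rewrite dot_mulmx [leRHS]dotC !dotE.
by apply: ler_sum => j _; rewrite ler_wpM2l.
Qed.

Lemma recourse_ge_dual l :
  Lambda l -> ((dot (h - T *m x) l)%:E <= recourse W q T h x)%E.
Proof.
move=> Ll; apply: le_ereal_inf_tmp => _ [y yS <-].
by rewrite lee_fin weak_duality.
Qed.

(* Farkas' lemma for the columns that are tight at [l]: either it yields a primal
   solution complementary to [l], or a direction improving [l]. *)
Lemma strong_duality l : is_optimal_dual W q T h x l ->
  recourse W q T h x = (dot (h - T *m x) l)%:E.
Proof.
move=> [Ll lmax]; apply/eqP; rewrite eq_le recourse_ge_dual ?andbT //.
set b := h - T *m x.
pose tight j := (W^T *m l) j 0 == q j 0.
have [[y y0 bE]|[d dle bd]] :=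
    farkas (fun j => if tight j then col j W else 0) b.
  (* Columns that are not tight were replaced by 0, so their multipliers are arbitrary and are reset
     to 0. *)
  pose y' := \col_j (if tight j then y j else 0).
  have y'S : recourse_set W T h x y'.
    split=> [|j]; last by rewrite mxE; case: ifP.
    rewrite -/b bE; apply/colP => i; rewrite mxE summxE.
    apply: eq_bigr => j _; rewrite !mxE mulrC.
    by case: ifP; rewrite ?mul0r !mxE ?mulr0.
  apply: ge_ereal_inf; exists (dot q y')%:E; first by exists y'.
  have <- : W *m y' = b by case: y'S.
  rewrite lee_fin dot_mulmx dotC !dotE.
  apply: ler_sum => j _; rewrite mxE; case: ifP => [/eqP ->//|_].
  by rewrite !mul0r.
exfalso.
(* Go to the first blocking constraint, or by 1 if no constraint grows along [d]. *)
have [e e0 Le] : exists2 e : R, 0 < e & Lambda (l + e *: d).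
  have [[j dj]|/forallNP dj] := pselect (exists j, 0 < (W^T *m d) j 0).
    have tightd i : (W^T *m l) i 0 = q i 0 -> (W^T *m d) i 0 <= 0.
      by move=> /eqP li; move: (dle i); rewrite /tight li mulmx_tr_dot.
    by have [e [_ [e0 Le _ _]]] := move_to_boundary Ll tightd dj; exists e.
  exists 1 => // j; rewrite mulmxDr scale1r mxE.
  apply: le_trans (Ll j); rewrite gerDl leNgt; exact/negP/dj.
have := lmax _ Le; rewrite -/b dotDr dotZr gerDl pmulr_rle0 //; lra.
Qed.

End Duality.

(** Clears the normalisation, turning the left side of an aggregated cut into a weighted sum over
    scenarios. *)
Lemma agg_residual (R : realType) (S : finType) (k n : nat) (p : S -> R)
    (T : S -> 'M[R]_(k, n)) (h : S -> 'cV[R]_k) (P : {set S}) (x : 'cV[R]_n) :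
  agg_prob p P != 0 ->
  agg_prob p P *: (agg p h P - agg p T P *m x)
    = \sum_(s in P) p s *: (h s - T s *m x).
Proof.
move=> P0; rewrite scalerBr scalemxAl /agg !scalerA divff // !scale1r.
rewrite mulmx_suml -sumrB; apply: eq_bigr => s _.
by rewrite scalerBr scalemxAl.
Qed.

(** * Optimality for the two-stage program *)

Unset Implicit Arguments.
Set Strict Implicit.

Theorem proposition3 (R : realType) (S : finType) (n k m : nat)
  (c : 'cV[R]_n) (X : set 'cV[R]_n)
  (X_nonempty : X !=set0) (X_closed : closed X)
  (p : S -> R) (p_gt0 : forall s, 0 < p s) (p_sum1 : \sum_(s : S) p s = 1)
  (T : S -> 'M[R]_(k, n)) (h : S -> 'cV[R]_k)
  (W : 'M[R]_(k, m)) (q : 'cV[R]_m)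
  (exists_xbar : exists xbar : 'cV[R]_n,
     forall s, recourse_feasible_bounded W q (T s) (h s) xbar)
  (Part : {set {set S}}) (Part_partition : finset.partition Part [set: S]%SET)
  (xs : 'cV[R]_n)
  (xs_optimal : exists theta : S -> R,
     is_minimizer (master_set X W q p T h Part) (master_cost c p) (xs, theta))
  (exists_duals : exists lam : S -> 'cV[R]_k,
     (forall s, is_optimal_dual W q (T s) (h s) xs (lam s)) /\
     forall P : {set S}, P \in Part ->
       (\sum_(s in P) p s) * (\sum_(s in P) p s * dot (h s) (lam s))
         = dot (\sum_(s in P) p s *: h s) (\sum_(s in P) p s *: lam s)
       /\
       (\sum_(s in P) p s) * (\sum_(s in P) p s * dot (T s *m xs) (lam s))
         = dot (\sum_(s in P) p s *: (T s *m xs)) (\sum_(s in P) p s *: lam s)) :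
  is_minimizer X (two_stage_cost W q c p T h) xs.
Proof.
have [theta [[/= Xxs cuts _] _ xs_min]] := xs_optimal.
have {exists_duals} [lam [lam_opt lam_cond]] := exists_duals.
pose Q' s := dot (h s - T s *m xs) (lam s).
have p_ge0 s : 0 <= p s by exact: ltW.
(* Without extreme points [theta] would be unconstrained, and the master problem
   unbounded. *)
have [l0 l0_ext] : exists l0, extreme_points (dual_polyhedron W q) l0.
  apply: contrapT => /forallNP no_ext.
  have /xs_min : master_set X W q p T h Part (xs, fun s => theta s - 1).
    by case: xs_optimal => th [[_ _ rays] _ _]; split=> // l P /no_ext.
  rewrite /master_cost lee_fin /=.
  under [X in _ <= _ + X -> _]eq_bigr do rewrite mulrBr mulr1.
  rewrite sumrB p_sum1; lra.
have [Ll0 _] := l0_ext.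
have agg_gt0 (P : {set S}) : P \in Part -> 0 < agg_prob p P.
  move=> PPart; have /set0Pn[s sP] : P != finset.set0.
    by case/and3P: Part_partition => _ _; apply: contraNneq => <-.
  by rewrite /agg_prob (bigD1 s) //= ltr_pwDl // sumr_ge0.
have block_le (P : {set S}) : P \in Part ->
    \sum_(s in P) p s * Q' s <= \sum_(s in P) p s * theta s.
  move=> PPart; have [condh condT] := lam_cond P PPart.
  have pP0 := agg_gt0 _ PPart.
  pose g := \sum_(s in P) p s *: (h s - T s *m xs).
  have gE x : dot g x = \sum_(s in P) p s * dot (h s - T s *m xs) x.
    by rewrite /g dot_suml; apply: eq_bigr => s _; rewrite dotZl.
  (* Each [lam s] maximises its own scenario term, so [g] is bounded on the polyhedron. *)
  have gM x : dual_polyhedron W q x -> dot g x <= \sum_(s in P) p s * Q' s.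
    move=> Lx; rewrite gE; apply: ler_sum => s _; rewrite ler_wpM2l //.
    by case: (lam_opt s) => _; exact.
  pose lbar := agg p lam P.
  have Llbar : dual_polyhedron W q lbar.
    move=> j; rewrite /lbar /agg -scalemxAr mxE mulmx_sumr summxE.
    rewrite mulrC ler_pdivrMr // /agg_prob mulr_sumr.
    apply: ler_sum => s _; rewrite -scalemxAr mxE mulrC ler_wpM2r //.
    by case: (lam_opt s) => Ls _; exact: Ls.
  (* After scaling by the block probability, this is the difference of the two hypotheses on the
     duals. *)
  have glbar : \sum_(s in P) p s * Q' s = dot g lbar.
    apply: (mulfI (lt0r_neq0 pP0)).
    rewrite /lbar /agg dotZr mulrA divff ?gt_eqF // mul1r.
    have -> : g = \sum_(s in P) p s *: h s - \sum_(s in P) p s *: (T s *m xs).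
      by rewrite /g -sumrB; apply: eq_bigr => s _; rewrite scalerBr.
    rewrite dotBl -condh -condT -mulrBr -sumrB; congr (_ * _).
    by apply: eq_bigr => s _; rewrite /Q' dotBl mulrBr.
  have [e e_ext le] := extreme_point_dominates l0_ext gM Llbar.
  by rewrite glbar (le_trans le) // /g -agg_residual ?gt_eqF // dotZl cuts.
have cost_xs : two_stage_cost W q c p T h xs
    = (dot c xs + \sum_s p s * Q' s)%:E.
  rewrite /two_stage_cost EFinD -sumEFin; congr (_ + _)%E.
  by apply: eq_bigr => s _; rewrite (strong_duality (lam_opt s)).
have xs_le_master : ((dot c xs + \sum_s p s * Q' s)%:E
    <= master_cost c p (xs, theta))%E.
  rewrite lee_fin lerD2l.
  have sumS (F : S -> R) : \sum_s F s = \sum_(s in [set: S]%SET) F s.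
    by apply: eq_bigl => s; rewrite finset.in_setT.
  rewrite !sumS !(set_partition_big _ Part_partition).
  by apply: ler_sum => P; exact: block_le.
split=> // [|y Xy]; first by rewrite cost_xs.
rewrite cost_xs; apply: (le_trans xs_le_master).
pose Qy s := recourse W q (T s) (h s) y.
(* Weak duality at the dual feasible [l0] excludes [-oo]. *)
have Qy_Ny s : Qy s != -oo%E.
  by rewrite -ltNye (lt_le_trans _ (recourse_ge_dual _ _ _ Ll0)) ?ltNyr.
have [Qy_lty|/existsNP[s /negP]] := pselect (forall s, (Qy s < +oo)%E); last first.
  rewrite -leNgt leye_eq => /eqP Qsy.
  have -> : two_stage_cost W q c p T h y = +oo%E; last exact: leey.
  rewrite /two_stage_cost.
  suff -> : (\sum_s (p s)%:E * Qy s = +oo)%E by rewrite addey.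
  apply/esum_eqyP => [s' _|]; last first.
    by exists s; rewrite mem_index_enum Qsy gt0_muley ?lte_fin.
  case: (Qy s') (Qy_Ny s') => [r||] // _.
  by rewrite gt0_muley ?lte_fin.
have Qy_fin s : Qy s \is a fin_num by rewrite fin_numE Qy_Ny lt_eqF.
have Qy_dual s l : dual_polyhedron W q l -> dot (h s - T s *m y) l <= fine (Qy s).
  by move=> Ll; rewrite -lee_fin fineK //; exact: recourse_ge_dual.
have -> : two_stage_cost W q c p T h y = master_cost c p (y, fine \o Qy).
  rewrite /two_stage_cost /master_cost EFinD -sumEFin; congr (_ + _)%E.
  by apply: eq_bigr => s _; rewrite EFinM /= fineK.
apply: xs_min; split=> //= [l P [Ll _] PPart|r s [rec _ _]].
  rewrite -dotZl agg_residual ?gt_eqF ?agg_gt0 // dot_suml.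
  by apply: ler_sum => s _; rewrite dotZl ler_wpM2l // Qy_dual.
(* A value below [+oo] provides a second-stage solution [y']; the ray cut follows from [y' >= 0] and
   [W^T r <= 0]. *)
have [y' [yS y0]] : recourse_set W (T s) (h s) y !=set0.
  apply/set0P/eqP => S0; move: (Qy_lty s).
  by rewrite /Qy /recourse S0 image_set0 ereal_inf0.
rewrite -yS dot_mulmx dotE sumr_le0 // => j _.
by rewrite mulr_ge0_le0 // (dual_recession_le0 Ll0).
Qed.
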